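(* Not every cosimple gammoid of corank at least two has a positive double circuit; that is, there exists a cosimple gammoid of corank at least two that has no positive double circuit. Equivalently, not every simple gammoid of rank at least two has a positive coline; that is, there exists a simple gammoid of rank at least two that has no positive coline.
   Context: All matroids are finite. The class of gammoids is the smallest class of matroids that contains all transversal matroids and is closed under duality and under taking minors. A matroid is cosimple if its dual is simple. The corank of a matroid is the rank of its dual. A double circuit of a matroid $M$ with rank function $r$ is a set $D\subseteq E(M)$ such that $r(D)=|D|-2$ and $r(D-d)=|D|-2$ for every $d\in D$. Every double circuit $D$ has a unique partition $(D_1,\dots,D_k)$ into nonempty classes, its circuit partition, such that the circuits of $M$ contained in $D$ are exactly the sets $D\setminus D_i$. A class is singular if it has exactly one element and multiple otherwise. A double circuit is positive if its circuit partition has more singular than multiple classes. A copoint of $M$ is a hyperplane (flat of codimension $1$) and a coline of $M$ is a flat $L$ of codimension $2$. For a coline $L$ there is a unique partition $(H_1,\dots,H_k)$ of $E(M)\setminus L$ into nonempty classes, its copoint partition, such that the copoints containing $L$ are exactly the sets $L\cup H_i$. A class is singular if it has exactly one element and multiple otherwise. A coline is positive if its copoint partition has more singular than multiple classes. *)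

(* Defs.v *)
From HB Require Import structures.
From mathcomp Require Import all_boot.
From mathcomp Require Import zify.

Set Implicit Arguments.
Unset Strict Implicit.
Unset Printing Implicit Defensive.

(* The ground set of a matroid is a whole finite type, so that deleting or
   contracting a set changes the type. *)
Record matroid (T : finType) := Matroid {
  indep : {set {set T}};
  indep0 : set0 \in indep;
  indepS : forall I J : {set T}, J \in indep -> I \subset J -> I \in indep;
  indep_aug : forall I J : {set T}, I \in indep -> J \in indep ->
    #|I| < #|J| -> exists2 x, x \in J :\: I & x |: I \in indep
}.

Section Rank.
Variables (T : finType) (M : matroid T).
Implicit Types I B C D F H L X Y S : {set T}.

Definition rank X : nat := \max_(I in indep M | I \subset X) #|I|.

Definition circuit C : bool :=
  (C \notin indep M) && [forall I : {set T}, (I \proper C) ==> (I \in indep M)].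

Definition simple : Prop := forall C, circuit C -> 2 < #|C|.

Definition flat F : bool := [forall x, (x \notin F) ==> (rank F < rank (x |: F))].

Lemma leq_rank I X : I \in indep M -> I \subset X -> #|I| <= rank X.
Proof.
by move=> iI IX; apply: (@leq_bigmax_cond _ _ (fun I => #|I|)); rewrite iI.
Qed.

Lemma rank_basis X : exists I, [/\ I \in indep M, I \subset X & #|I| = rank X].
Proof.
have ne : 0 < #|[pred I : {set T} | (I \in indep M) && (I \subset X)]|.
  by apply/card_gt0P; exists set0; rewrite inE indep0 sub0set.
have [I /andP[iI IX] eI] := eq_bigmax_cond (fun I : {set T} => #|I|) ne.
by exists I; split; rewrite // -eI; apply: eq_bigl.
Qed.

Lemma indep_extend I X : I \in indep M -> I \subset X ->
  exists B, [/\ B \in indep M, I \subset B, B \subset X & #|B| = rank X].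
Proof.
have [n] := ubnP (rank X - #|I|).
elim: n I => // n IHn I ltn iI IX.
have := leq_rank iI IX; rewrite leq_eqVlt => /orP[/eqP eI | ltI].
  by exists I.
have [J [iJ JX eJ]] := rank_basis X.
have [|x /setDP[xJ xI] ixI] := indep_aug iI iJ; first by rewrite eJ.
have [||B [iB IB BX eB]] := IHn (x |: I) _ ixI.
- by rewrite cardsU1 xI; lia.
- by rewrite subUset sub1set (subsetP JX) //.
exists B; split=> //; exact: subset_trans (subsetUr _ _) IB.
Qed.

Definition dual_indep : {set {set T}} := [set X | rank (~: X) == rank setT].

Lemma rankS X Y : X \subset Y -> rank X <= rank Y.
Proof.
move=> XY; have [I [iI IX <-]] := rank_basis X.
by apply: leq_rank => //; exact: subset_trans XY.
Qed.

Lemma dual_indep0 : set0 \in dual_indep.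
Proof. by rewrite inE setC0. Qed.

Lemma dual_indepS I J : J \in dual_indep -> I \subset J -> I \in dual_indep.
Proof.
rewrite !inE => /eqP rJ IJ; rewrite eqn_leq rankS ?subsetT //= -rJ.
by rewrite rankS // setCS.
Qed.

Lemma dual_indep_aug I J : I \in dual_indep -> J \in dual_indep ->
  #|I| < #|J| -> exists2 x, x \in J :\: I & x |: I \in dual_indep.
Proof.
rewrite !inE => /eqP rI /eqP rJ ltIJ.
have [B0 [iB0 B0J eB0]] := rank_basis (~: J).
have iK : B0 :\: I \in indep M by apply: indepS iB0 _; exact: subsetDl.
have KI : B0 :\: I \subset ~: I by rewrite setDE subsetIr.
have [B [iB KB BI eB]] := indep_extend iK KI.
have [JB | /subsetPn[x xJI xB]] := boolP (J :\: I \subset B); last first.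
  exists x => //; rewrite inE eqn_leq rankS ?subsetT //= -rI -eB.
  apply: leq_rank => //; rewrite setCU subsetI BI andbT.
  by apply/subsetP => y yB; rewrite !inE; apply: contraNneq xB => <-.
exfalso.
have dis : [disjoint B0 :\: I & J :\: I].
  rewrite -setI_eq0 -subset0; apply/subsetP => y; rewrite !inE.
  case/andP=> /andP[_ yB0] /andP[_ yJ].
  by have := subsetP B0J y yB0; rewrite inE yJ.
have le1 : #|B0 :\: I| + #|J :\: I| <= #|B|.
  rewrite -cardsUI (disjoint_setI0 dis) cards0 addn0; apply: subset_leq_card.
  by rewrite subUset KB.
have le2 : #|B0 :&: I| <= #|I :\: J|.
  by apply: subset_leq_card; rewrite setDE setIC setIS.
have := cardsID I B0; have := cardsID J I; have := cardsID I J.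
rewrite [J :&: I]setIC; lia.
Qed.

Definition dual : matroid T := Matroid dual_indep0 dual_indepS dual_indep_aug.

End Rank.

Section Minor.
Variables (T : finType) (M : matroid T) (X : {set T}).

Let U : finType := {x : T | x \notin X}.

Definition delete_indep : {set {set U}} :=
  [set I : {set U} | [set val x | x in I] \in indep M].

Lemma delete_indep0 : set0 \in delete_indep.
Proof. by rewrite inE imset0 indep0. Qed.

Lemma delete_indepS (I J : {set U}) :
  J \in delete_indep -> I \subset J -> I \in delete_indep.
Proof. by rewrite !inE => iJ IJ; apply: indepS iJ _; exact: imsetS. Qed.

Lemma delete_indep_aug (I J : {set U}) :
  I \in delete_indep -> J \in delete_indep -> #|I| < #|J| ->
  exists2 x, x \in J :\: I & x |: I \in delete_indep.
Proof.
rewrite !inE => iI iJ; rewrite -(card_imset (mem I) val_inj).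
rewrite -(card_imset (mem J) val_inj) => lt.
have [_ /setDP[/imsetP[x xJ ->] xI] ix] := indep_aug iI iJ lt.
exists x; last by rewrite inE imsetU1.
by rewrite inE xJ andbT; apply: contra xI => xI; apply/imsetP; exists x.
Qed.

Definition delete : matroid U :=
  Matroid delete_indep0 delete_indepS delete_indep_aug.

End Minor.

Definition contract (T : finType) (M : matroid T) (X : {set T}) :
  matroid {x : T | x \notin X} := dual (delete (dual M) X).

Definition isomorphic (T U : finType) (M : matroid T) (N : matroid U) : Prop :=
  exists2 f : T -> U, bijective f &
    forall X : {set T}, (f @: X \in indep N) = (X \in indep M).

(* The independent sets are the partial transversals of a finite family. *)
Definition transversal (T : finType) (M : matroid T) : Prop :=
  exists (J : finType) (A : J -> {set T}), forall X : {set T},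
    X \in indep M <->
    exists2 f : {x : T | x \in X} -> J, injective f &
      forall x, val x \in A (f x).

(* A class of matroids is understood to be closed under isomorphism. *)
Inductive gammoid : forall T : finType, matroid T -> Prop :=
| gammoid_transversal (T : finType) (M : matroid T) :
    transversal M -> gammoid M
| gammoid_dual (T : finType) (M : matroid T) :
    gammoid M -> gammoid (dual M)
| gammoid_delete (T : finType) (M : matroid T) (X : {set T}) :
    gammoid M -> gammoid (delete M X)
| gammoid_contract (T : finType) (M : matroid T) (X : {set T}) :
    gammoid M -> gammoid (contract M X)
| gammoid_iso (T U : finType) (M : matroid T) (N : matroid U) :
    isomorphic M N -> gammoid M -> gammoid N.

Section Positivity.
Variables (T : finType) (M : matroid T).
Implicit Types (C D H L : {set T}) (P : {set {set T}}).

Definition cosimple : Prop := simple (dual M).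

Definition corank : nat := rank (dual M) setT.

Definition more_singular P : bool :=
  #|[set B in P | #|B| != 1]| < #|[set B in P | #|B| == 1]|.

(* Equations on |D| rather than |D| - 2, since subtraction is truncated. *)
Definition double_circuit D : Prop :=
  (rank M D).+2 = #|D| /\ forall d, d \in D -> (rank M (D :\ d)).+2 = #|D|.

Definition circuit_partition D P : Prop :=
  partition P D /\
  [set C | circuit M C & C \subset D] = [set D :\: B | B in P].

Definition positive_double_circuit D : Prop :=
  double_circuit D /\ exists2 P, circuit_partition D P & more_singular P.

Definition copoint H : bool := flat M H && ((rank M H).+1 == rank M setT).

Definition coline L : bool := flat M L && ((rank M L).+2 == rank M setT).

Definition copoint_partition L P : Prop :=
  partition P (~: L) /\
  [set H | copoint H & L \subset H] = [set L :|: B | B in P].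

Definition positive_coline L : Prop :=
  coline L /\ exists2 P, copoint_partition L P & more_singular P.

End Positivity.

(* Main.v *)
Require Import Defs.
From mathcomp Require Import all_boot.
From mathcomp Require Import zify.

Set Implicit Arguments.
Unset Strict Implicit.
Unset Printing Implicit Defensive.

(* The bicircular matroid of the Petersen graph (girth 5, minimum degree 3) is a
   counterexample, and its dual is one for colines.

   Write V(X) for the vertices met by an edge set X.  Circuits C satisfy
   |V(C)| = |C| - 1 and have minimum degree at least 2, and a double circuit D
   satisfies |V(D)| >= |D| - 2.  Hence the degree excess over 2 sums to at most 4
   in D, so at most 4 vertices have degree above 2.  A singular edge has
   both ends among them, since deleting it leaves a circuit.  By the girth
   condition the set S of singular edges is a forest: |S| < |V(S)| <= 4, so
   |S| <= 3, and a positive D has at most two multiple classes.  With at most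
   one, S contains a circuit; with exactly two, S is the intersection of two
   circuits with union D, and submodularity of |V(.)| gives |V(S)| <= |S|.
   Both contradict the girth condition. *)

(** * Hall's condition, matchings, and transversal matroids *)

Section Hall.
Variables T J : finType.
Implicit Types (A : T -> {set J}) (X Y : {set T}).

Definition nbh A X : {set J} := \bigcup_(x in X) A x.

Definition hall A X : bool :=
  [forall Y : {set T}, (Y \subset X) ==> (#|Y| <= #|nbh A Y|)].

Lemma hallP A X :
  reflect (forall Y, Y \subset X -> #|Y| <= #|nbh A Y|) (hall A X).
Proof. exact: 'forall_implyP. Qed.

Lemma nbhS A X Y : X \subset Y -> nbh A X \subset nbh A Y.
Proof.
move=> XY; apply/bigcupsP => x xX; apply: bigcup_sup.
exact: (subsetP XY).
Qed.

Lemma nbhU A X Y : nbh A (X :|: Y) = nbh A X :|: nbh A Y.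
Proof. exact: bigcup_setU. Qed.

Lemma nbh1 A x : nbh A [set x] = A x.
Proof. exact: big_set1. Qed.

Lemma mem_nbh A X x v : x \in X -> v \in A x -> v \in nbh A X.
Proof. by move=> xX vx; apply/bigcupP; exists x. Qed.

Lemma nbh_submod A X Y :
  #|nbh A (X :|: Y)| + #|nbh A (X :&: Y)| <= #|nbh A X| + #|nbh A Y|.
Proof.
rewrite nbhU -[leqRHS]cardsUI leq_add2l; apply: subset_leq_card.
by rewrite subsetI !nbhS // ?subsetIl ?subsetIr.
Qed.

Lemma leq_nbh A X (f : T -> J) :
  {in X &, injective f} -> {in X, forall x, f x \in A x} -> #|X| <= #|nbh A X|.
Proof.
move=> f_inj fA; rewrite -(card_in_imset f_inj); apply: subset_leq_card.
by apply/subsetP => _ /imsetP[x xX ->]; exact: mem_nbh (fA x xX).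
Qed.

(* Rado's argument: while some [A x] has two elements, one of them can be
   dropped without violating Hall's condition. *)
Lemma hall_matching A :
  (forall X, #|X| <= #|nbh A X|) ->
  exists2 f : T -> J, injective f & forall x, f x \in A x.
Proof.
have [n] := ubnP (\sum_x #|A x|); elim: n A => // n IHn A ltn hA.
have [/forallP A1 | /forallPn[x]] := boolP [forall x, #|A x| <= 1].
  have A1' x : exists j, A x == [set j].
    have /cards1P[j ->] : #|A x| == 1; last by exists j.
    by rewrite eqn_leq A1; have:= hA [set x]; rewrite nbh1 cards1.
  exists (fun x => xchoose (A1' x)); last first.
    by move=> x; rewrite {2}(eqP (xchooseP (A1' x))) set11.
  move=> x y exy; apply/eqP/contraT => nxy; have:= hA [set x; y].
  rewrite cards2 nxy nbhU !nbh1.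
  by rewrite (eqP (xchooseP (A1' x))) (eqP (xchooseP (A1' y))) exy setUid cards1.
rewrite -ltnNge => /card_gt1P[j1 [j2 [j1x j2x nj]]].
pose drop j y := if y == x then A x :\ j else A y.
have drop_sub j y : drop j y \subset A y.
  by rewrite /drop; case: eqP => // ->; exact: subsetDl.
have finish j : j \in A x -> (forall X, #|X| <= #|nbh (drop j) X|) ->
    exists2 f : T -> J, injective f & forall x, f x \in A x.
  move=> jx hj; have [|f f_inj fA] := IHn (drop j) _ hj.
    apply: leq_trans (_ : _ < \sum_x #|A x|) ltn; rewrite (bigD1 x) //= [ltnRHS](bigD1 x) //=.
    rewrite -addSn leq_add //; last by apply: leq_sum => y /negPf; rewrite /drop => ->.
    by rewrite /drop eqxx (cardsD1 j (A x)) jx.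
  by exists f => // y; exact: subsetP (drop_sub j y) _ (fA y).
have [/forallP h1 | /forallPn[X1 lt1]] :=
  boolP [forall X : {set T}, #|X| <= #|nbh (drop j1) X|]; first exact: finish j1x h1.
have [/forallP h2 | /forallPn[X2 lt2]] :=
  boolP [forall X : {set T}, #|X| <= #|nbh (drop j2) X|]; first exact: finish j2x h2.
have split_nbh j X : #|nbh (drop j) X| < #|X| ->
    x \in X /\ nbh (drop j) X = nbh A (X :\ x) :|: (A x :\ j).
  move=> ltX; have drop_out Y : x \notin Y -> nbh (drop j) Y = nbh A Y.
    move=> xY; apply: eq_bigr => y yY; rewrite /drop; case: eqP => // eyx.
    by rewrite -eyx yY in xY.
  have xX : x \in X.
    by apply: contraTT ltX => xX; rewrite -leqNgt drop_out.
  split=> //; rewrite -{1}(setD1K xX) nbhU nbh1 setUC drop_out ?setD11 //.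
  by rewrite /drop eqxx.
(* Both violators contain [x]. As [j1 != j2], their reduced neighbourhoods together cover [A x], so
   Hall's condition for [x |: (Y1 :|: Y2)] and for [Y1 :&: Y2] bounds the sum of their sizes below
   by [#|Y1| + #|Y2| + 1], whereas each has size at most [#|Y1|], resp. [#|Y2|]. *)
rewrite -ltnNge in lt1; rewrite -ltnNge in lt2.
have [xX2 e2] := split_nbh _ _ lt2; have [xX1 e1] := split_nbh _ _ lt1.
set Y1 := X1 :\ x in e1; set Y2 := X2 :\ x in e2.
have hU : #|Y1 :|: Y2|.+1 <= #|nbh A (Y1 :|: Y2) :|: A x|.
  have:= hA (x |: (Y1 :|: Y2)); rewrite nbhU nbh1 [A x :|: _]setUC cardsU1.
  by rewrite /Y1 /Y2 !inE eqxx.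
have hI := hA (Y1 :&: Y2).
have sU : nbh A (Y1 :|: Y2) :|: A x
    \subset nbh (drop j1) X1 :|: nbh (drop j2) X2.
  rewrite e1 e2 nbhU; apply/subsetP => j; rewrite !inE => /orP[/orP[]->|->];
    rewrite ?orbT ?andbT //.
  case: (eqVneq j j1) => [->|_]; last by rewrite orbT.
  by rewrite nj !orbT.
have sI : nbh A (Y1 :&: Y2) \subset nbh (drop j1) X1 :&: nbh (drop j2) X2.
  rewrite e1 e2 subsetI !subsetU //; first by rewrite nbhS ?subsetIr.
  by rewrite nbhS ?subsetIl.
have := subset_leq_card sU; have := subset_leq_card sI.
have := cardsUI Y1 Y2; have := cardsUI (nbh (drop j1) X1) (nbh (drop j2) X2).
move: lt1 lt2; rewrite (cardsD1 x X1) (cardsD1 x X2) xX1 xX2 -/Y1 -/Y2; lia.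
Qed.

Lemma hall0 A : hall A set0.
Proof. by apply/hallP => Y; rewrite subset0 => /eqP->; rewrite cards0. Qed.

Lemma hallS A X Y : hall A Y -> X \subset Y -> hall A X.
Proof.
move=> /hallP hY XY; apply/hallP => Z ZX; apply: hY; exact: subset_trans XY.
Qed.

(** Submodularity leaves no slack: Hall's condition bounds the neighbourhoods of both union and
    intersection from below. *)
Lemma hall_tightU A X Y Z : hall A Z -> X \subset Z -> Y \subset Z ->
  #|nbh A X| = #|X| -> #|nbh A Y| = #|Y| ->
  #|nbh A (X :|: Y)| = #|X :|: Y|.
Proof.
move=> /hallP hZ XZ YZ eX eY; apply/eqP; rewrite eqn_leq hZ ?subUset ?XZ // andbT.
have := hZ (X :&: Y) (subset_trans (subsetIl _ _) XZ).
have := nbh_submod A X Y; have := cardsUI X Y; lia.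
Qed.

(** If nothing can be added, each [x] of [Y :\: X] is blocked by a tight subset of [X] whose
    neighbourhood contains [A x]. The union [Z] of these sets is again tight, and [Y] has too many
    elements with neighbours only in [nbh A Z]. *)
Lemma hall_aug A X Y : hall A X -> hall A Y -> #|X| < #|Y| ->
  exists2 x, x \in Y :\: X & hall A (x |: X).
Proof.
move=> hX hY ltXY.
have [/exists_inP[x] | /exists_inPn noaug] :=
  boolP [exists x in Y :\: X, hall A (x |: X)]; first by exists x.
have block x : x \in Y :\: X ->
    exists Z : {set T}, [/\ Z \subset X, #|nbh A Z| = #|Z| & A x \subset nbh A Z].
  move=> xYX; have /setDP[_ xX] := xYX.
  have /forallPn[Z] := noaug x xYX; rewrite negb_imply -ltnNge => /andP[ZX ltZ].
  have xZ : x \in Z.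
    apply: contraTT ltZ => xZ; rewrite -leqNgt; apply: (hallP _ _ hX).
    apply/subsetP => y yZ; have := subsetP ZX y yZ; rewrite !inE.
    by case: eqP => // eyx; rewrite -eyx yZ in xZ.
  exists (Z :\ x); have ZxX : Z :\ x \subset X by rewrite subDset.
  have h1 := hallP _ _ hX _ ZxX.
  have h2 : #|nbh A (Z :\ x)| <= #|nbh A Z|.
    by rewrite subset_leq_card ?nbhS ?subsetDl.
  have h3 : #|nbh A Z| <= #|nbh A (Z :\ x)|.
    by move: ltZ; rewrite (cardsD1 x Z) xZ; lia.
  split=> //; first by move: ltZ; rewrite (cardsD1 x Z) xZ; lia.
  suff -> : nbh A (Z :\ x) = nbh A Z by exact: bigcup_sup.
  by apply/eqP; rewrite eqEcard nbhS ?subsetDl.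
have [Z [ZX eZ nZ]] : exists Z : {set T},
    [/\ Z \subset X, #|nbh A Z| = #|Z| & nbh A (Y :\: X) \subset nbh A Z].
  have: {subset enum (Y :\: X) <= Y :\: X} by move=> x; rewrite mem_enum.
  rewrite /nbh -big_enum /=; elim: (enum _) => [|x s IHs] sYX.
    by exists set0; rewrite sub0set big_nil sub0set /nbh big_set0 !cards0.
  have [|Z1 [Z1X e1 n1]] := block x; first by apply: sYX; rewrite mem_head.
  have [|Z2 [Z2X e2 n2]] := IHs; first by move=> y ys; apply: sYX; rewrite inE ys orbT.
  exists (Z1 :|: Z2); split; first by rewrite subUset Z1X.
    exact: hall_tightU hX Z1X Z2X e1 e2.
  by rewrite big_cons -/(nbh A _) nbhU setUSS.
have dis : [disjoint Y :\: X & Z].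
  rewrite -setI_eq0 -subset0; apply/subsetP => y; rewrite !inE.
  by case/andP => /andP[/negP yX _] /(subsetP ZX).
(* This gives [#|Y :\: X| + #|Y :&: Z| <= #|Z|], hence [#|Y :\: X| <= #|Z :\: Y| <= #|X :\: Y|],
   against [#|X| < #|Y|]. *)
have := hallP _ _ hY ((Y :\: X) :|: (Y :&: Z)).
rewrite subUset subsetDl subsetIl => /(_ isT).
have: #|nbh A ((Y :\: X) :|: (Y :&: Z))| <= #|nbh A Z|.
  by apply: subset_leq_card; rewrite nbhU subUset nZ nbhS ?subsetIr.
have := cardsUI (Y :\: X) (Y :&: Z).
have -> : (Y :\: X) :&: (Y :&: Z) = set0.
  by rewrite setIC -setIA [Z :&: _]setIC (disjoint_setI0 dis) setI0.
have := subset_leq_card (setSD Y ZX).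
have := cardsID Y Z; have := cardsID X Y; have := cardsID Y X.
rewrite [Z :&: Y]setIC [Y :&: X]setIC cards0; lia.
Qed.

Definition hall_indep A : {set {set T}} := [set X | hall A X].

Lemma hall_indep0 A : set0 \in hall_indep A.
Proof. by rewrite inE hall0. Qed.

Lemma hall_indepS A X Y : Y \in hall_indep A -> X \subset Y -> X \in hall_indep A.
Proof. by rewrite !inE; exact: hallS. Qed.

Lemma hall_indep_aug A X Y : X \in hall_indep A -> Y \in hall_indep A ->
  #|X| < #|Y| -> exists2 x, x \in Y :\: X & x |: X \in hall_indep A.
Proof.
rewrite !inE => hX hY /(hall_aug hX hY)[x xYX hx].
by exists x; rewrite ?inE -?in_setD.
Qed.

Definition hall_matroid A : matroid T :=
  Matroid (@hall_indep0 A) (@hall_indepS A) (@hall_indep_aug A).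

End Hall.

Lemma transversal_hall (T J : finType) (A : T -> {set J}) :
  Defs.transversal (hall_matroid A).
Proof.
exists J, (fun j => [set x | j \in A x]) => X; rewrite inE.
split=> [/hallP hX | [f f_inj fA]].
  (* [hall_matching] matches a whole type, so it is applied to the subtype of [X]. *)
  have [Y|f f_inj fA] := @hall_matching {x | x \in X} J (fun x => A (val x)).
    have := hX [set val x | x in Y]; rewrite card_imset; last exact: val_inj.
    have -> : nbh A [set val x | x in Y] = nbh (fun x => A (val x)) Y.
      by apply: big_imset => x y _ _; exact: val_inj.
    by apply; apply/subsetP => _ /imsetP[x _ ->]; exact: valP.
  by exists f => // x; rewrite inE.
apply/hallP => Y YX.
have [->|[y yY]] := set_0Vmem Y; first by rewrite cards0.
(* Default value for [insubd]; it is never taken on [Y], which lies in [X]. *)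
pose y' : {x | x \in X} := exist _ y (subsetP YX y yY).
apply: (@leq_nbh _ _ _ _ (fun x => f (insubd y' x))).
  move=> u v uY vY /f_inj/(congr1 val).
  by rewrite !val_insubd !(subsetP YX).
move=> x xY; have := fA (insubd y' x).
by rewrite inE val_insubd (subsetP YX).
Qed.

(** * Complementation between colines of the dual and double circuits *)

Section Duality.
Variables (T : finType) (M : matroid T).
Implicit Types C H L X : {set T}.

Lemma rank_le_card X : rank M X <= #|X|.
Proof. by have [I [_ IX <-]] := rank_basis M X; exact: subset_leq_card. Qed.

Lemma indep_rank X : (X \in indep M) = (rank M X == #|X|).
Proof.
apply/idP/eqP => [iX | eX].
  by apply/eqP; rewrite eqn_leq rank_le_card leq_rank.
have [I [iI IX eI]] := rank_basis M X.
suff <- : I = X by [].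
by apply/eqP; rewrite eqEcard IX eI eX leqnn.
Qed.

(** For the upper bound, a basis avoiding a dual-independent [I] is split along [X]. For the lower
    bound, a basis of [~: X] is extended to a basis [B] of [M], and [X :\: B] is
    dual-independent. *)
Lemma rank_dual X : rank (dual M) X + rank M setT = #|X| + rank M (~: X).
Proof.
apply/eqP; rewrite eqn_leq; apply/andP; split.
  have [I [iI IX <-]] := rank_basis (dual M) X; move: iI; rewrite inE => /eqP <-.
  have [B [iB BI <-]] := rank_basis M (~: I).
  have h : #|B :\: X| <= rank M (~: X).
    by apply: leq_rank; [exact: indepS iB (subsetDl _ _) | rewrite setDE subsetIr].
  have : #|B :&: X| <= #|X :\: I|.
    by apply: subset_leq_card; rewrite setDE setIC setIS.
  have := cardsID X B; have := cardsID I X; rewrite (setIidPr IX); lia.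
have [B0 [iB0 B0X <-]] := rank_basis M (~: X).
have [B [iB B0B _ eB]] := indep_extend iB0 (subsetT B0).
have : #|X :\: B| <= rank (dual M) X.
  apply: leq_rank; last exact: subsetDl.
  rewrite inE eqn_leq rankS ?subsetT //= -eB; apply: leq_rank iB _.
  by rewrite setDE setCI setCK subsetUr.
have : #|B0| <= #|B :\: X|.
  by apply: subset_leq_card; rewrite setDE subsetI B0B.
have := cardsID X B; have := cardsID B X; rewrite [B :&: X]setIC; lia.
Qed.

(** Codimension in the dual is nullity of the complement; [n] is 1 for copoints and 2 for
    colines. *)
Lemma corank_dual H n :
  (rank (dual M) H + n == rank (dual M) setT) = (rank M (~: H) + n == #|~: H|).
Proof.
have := rank_dual H; have := rank_dual setT; have := cardsC H.
have := rank_le_card set0; rewrite setCT cardsT cards0; lia.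
Qed.

(** By [rank_dual], adding [x] to [H] raises the dual rank exactly when removing [x] from the
    complement keeps its rank. *)
Lemma flat_dual H :
  flat (dual M) H = [forall x in ~: H, rank M (~: H :\ x) == rank M (~: H)].
Proof.
apply: eq_forallb => x; rewrite inE; apply: implyb_id2l => xH.
have := rank_dual H; have := rank_dual (x |: H); rewrite cardsU1 xH.
have -> : ~: (x |: H) = ~: H :\ x by rewrite setCU setIC -setDE.
have := rankS M (subsetDl (~: H) [set x]); lia.
Qed.

Lemma circuitP C :
  reflect ((rank M C).+1 = #|C| /\ {in C, forall x, rank M (C :\ x) = rank M C})
          (circuit M C).
Proof.
apply: (iffP andP) => [[dC /forall_inP iC] | [eC rC]].
  have r1 x : x \in C -> (rank M (C :\ x)).+1 = #|C|.
    move=> xC; have := iC _ (properD1 xC); rewrite indep_rank => /eqP->.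
    by rewrite (cardsD1 x C) xC.
  have ltC : rank M C < #|C| by rewrite ltn_neqAle -indep_rank dC rank_le_card.
  have [x xC] : exists x, x \in C by apply/card_gt0P; lia.
  have eC : (rank M C).+1 = #|C|.
    by have := r1 x xC; have := rankS M (subsetDl C [set x]); lia.
  by split=> // y yC; have := r1 y yC; lia.
split; first by rewrite indep_rank; lia.
apply/forall_inP => I /properP[IC [x xC xI]].
apply: (@indepS _ _ _ (C :\ x)); last by rewrite subsetD1 IC.
by rewrite indep_rank rC //; have := cardsD1 x C; rewrite xC; lia.
Qed.

Lemma copoint_dual H : copoint (dual M) H = circuit M (~: H).
Proof.
rewrite /copoint flat_dual -addn1 corank_dual addn1.
apply/andP/circuitP => -[].
  by move=> /forall_inP fH /eqP eH; split=> // x xH; exact/eqP/fH.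
by move=> -> fH; split=> //; apply/forall_inP => x /fH->.
Qed.

Lemma coline_dual L : coline (dual M) L -> double_circuit M (~: L).
Proof.
rewrite /coline flat_dual -addn2 corank_dual addn2 => /andP[/forall_inP fL /eqP eL].
by split=> // x /fL/eqP->.
Qed.

(** Complementation takes [L :|: B] to [~: L :\: B], so the same partition serves on both sides. *)
Lemma positive_coline_dual L :
  positive_coline (dual M) L -> positive_double_circuit M (~: L).
Proof.
move=> [/coline_dual dL [P [partP eP] posP]]; split=> //; exists P => //.
split=> //; apply/setP => C.
transitivity (~: C \in [set H | copoint (dual M) H & L \subset H]).
  by rewrite !inE copoint_dual setCK subsetC.
rewrite eP; apply/imsetP/imsetP => -[B BP eC]; exists B => //.
  by rewrite -[C]setCK eC setCU setDE.
by rewrite eC setDE setCI !setCK.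
Qed.

End Duality.

(** * Bicircular matroids: circuits, double circuits, cosimplicity *)

Lemma rank_hall_matroid (T J : finType) (A : T -> {set J}) X :
  rank (hall_matroid A) X <= #|nbh A X|.
Proof.
have [I [iI IX <-]] := rank_basis (hall_matroid A) X.
move: iI; rewrite inE => /hallP/(_ I (subxx _)) leI.
exact: leq_trans leI (subset_leq_card (nbhS _ IX)).
Qed.

(** Proper subsets are independent, so the set violating Hall's condition is [C] itself; the rank
    bounds the defect by one. *)
Lemma hall_circuit (T J : finType) (A : T -> {set J}) C :
  circuit (hall_matroid A) C -> #|nbh A C|.+1 = #|C|.
Proof.
move=> cC; have [eC _] := circuitP _ _ cC.
have /andP[dC /forall_inP iC] := cC.
have leC := rank_hall_matroid A C.
apply/eqP; rewrite eqn_leq -{2}eC ltnS leC andbT.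
move: dC; rewrite inE => /forallPn[X]; rewrite negb_imply -ltnNge => /andP[XC ltX].
have [->//|neX] := eqVneq C X.
have := iC X; rewrite properEneq eq_sym neX XC inE => /(_ isT)/hallP/(_ X (subxx _)).
by rewrite leqNgt ltX.
Qed.

(* A graph with edges [E] and vertices [V] is given by the endpoint sets [A e];
   [hall_matroid A] is then its bicircular matroid. *)
Section Graph.
Variables (E V : finType) (A : E -> {set V}).
Implicit Types (e : E) (v : V) (S C D : {set E}) (W : {set V}).
Local Notation M := (hall_matroid A).

Definition star D v : {set E} := [set e in D | v \in A e].

Lemma starS C D v : C \subset D -> star C v \subset star D v.
Proof. by move=> CD; apply/subsetP => e; rewrite !inE => /andP[/(subsetP CD)->]. Qed.

Lemma sum_star D W : \sum_(v in W) #|star D v| = \sum_(e in D) #|A e :&: W|.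
Proof.
under eq_bigr do rewrite -sum1dep_card.
rewrite (exchange_big_dep (mem D)) /=; last by move=> v e _ /andP[].
apply: eq_bigr => e eD; rewrite -sum1_card; apply: eq_bigl => v.
by rewrite !inE eD andbC.
Qed.

(** Removing the only edge at [v] would also lose [v], leaving an independent set with more edges
    than vertices. *)
Lemma circuit_star C v : circuit M C -> v \in nbh A C -> 1 < #|star C v|.
Proof.
move=> cC /bigcupP[e eC ve]; rewrite ltnNge; apply/negP => le1.
have eS : e \in star C v by rewrite inE eC.
have sub : nbh A (C :\ e) \subset nbh A C :\ v.
  rewrite subsetD1 nbhS ?subsetDl //=; apply/bigcupP => -[f].
  rewrite !inE => /andP[nfe fC] vf; case/negP: nfe; apply/eqP.
  by have := card_le1_eqP le1 e f; apply; rewrite inE ?fC ?eC.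
have /andP[_ /forall_inP/(_ _ (properD1 eC))] := cC.
rewrite inE => /hallP/(_ _ (subxx _)).
have := subset_leq_card sub; have := hall_circuit cC.
have := cardsD1 e C; have := cardsD1 v (nbh A C).
by rewrite eC (mem_nbh eC ve); lia.
Qed.

Hypothesis A2 : forall e, #|A e| = 2.
(* For simple graphs this says that the girth is at least 5. *)
Hypothesis sparse : forall S, S != set0 -> #|nbh A S| <= 4 -> #|S| < #|nbh A S|.

Lemma no_positive_double_circuit D : ~ positive_double_circuit M D.
Proof.
move=> [[rD _] [P [/and3P[/eqP covP trP n0P] eP]]].
have circP B : B \in P -> circuit M (D :\: B).
  move=> BP; have : D :\: B \in [set C | circuit M C & C \subset D].
    by rewrite eP imset_f.
  by rewrite inE => /andP[].
have subP B : B \in P -> B \subset D by move=> BP; rewrite -covP; exact: bigcup_sup.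
have disP B B' e : B \in P -> B' \in P -> e \in B -> e \in B' -> B = B'.
  by move=> BP B'P eB eB'; rewrite -(def_pblock trP BP eB) (def_pblock trP B'P eB').
have inP e : e \in D -> exists2 B, B \in P & e \in B.
  by rewrite -covP => /bigcupP[B]; exists B.
have circ_n0 C : circuit M C -> C != set0.
  by move=> cC; rewrite -card_gt0 -(hall_circuit cC).
have otherP e : e \in D -> exists2 B, B \in P & e \notin B.
  move=> eD; have [B BP eB] := inP e eD.
  have /set0Pn[f] := circ_n0 _ (circP B BP); rewrite inE => /andP[fB fD].
  have [B' B'P fB'] := inP f fD; exists B' => //.
  by apply: contra fB => eB'; rewrite (disP _ _ _ BP B'P eB eB').
have deg2 v : v \in nbh A D -> 1 < #|star D v|.
  case/bigcupP => e eD ve; have [B BP eB] := otherP e eD.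
  apply: leq_trans (subset_leq_card (starS v (subsetDl D B))).
  by apply: circuit_star; rewrite ?circP //; apply: mem_nbh ve; rewrite inE eB.
pose S := [set e | [set e] \in P].
pose branch := [set v in nbh A D | 2 < #|star D v|].
(* The degree sum [2 * #|D|] is at least [2 * #|nbh A D| + #|branch|], and [#|nbh A D|] is at least
   [#|D| - 2]. *)
have branch4 : #|branch| <= 4.
  have : \sum_(v in nbh A D) #|star D v| = 2 * #|D|.
    rewrite sum_star mulnC -sum_nat_const; apply: eq_bigr => e eD.
    by rewrite (setIidPl _) ?A2 //; exact: bigcup_sup.
  have : \sum_(v in nbh A D) (2 + (2 < #|star D v|)) <= \sum_(v in nbh A D) #|star D v|.
    apply: leq_sum => v /deg2; lia.
  rewrite big_split /= sum_nat_const -big_mkcondr /= sum1dep_card.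
  have := rank_hall_matroid A D; rewrite -/branch; lia.
have SD : S \subset D.
  by apply/subsetP => e; rewrite inE => /subP; rewrite sub1set.
(* An end [v] of a singular edge [e] keeps degree at least 2 in the circuit [D :\ e], so it is a
   branch vertex. *)
have nbhS4 : #|nbh A S| <= 4.
  apply: leq_trans branch4; apply: subset_leq_card.
  apply/subsetP => v /bigcupP[e eS ve]; have eD := subsetP SD e eS.
  rewrite inE (mem_nbh eD ve) /= (cardsD1 e) inE eD ve ltnS.
  have sub : star (D :\ e) v \subset star D v :\ e.
    by apply/subsetP => f; rewrite !inE andbA.
  apply: leq_trans (subset_leq_card sub); apply: circuit_star.
    by apply: circP; rewrite inE in eS.
  have := deg2 v (mem_nbh eD ve); rewrite (cardsD1 e) inE eD ve ltnS.
  case/card_gt0P => f; rewrite !inE => /and3P[fe fD vf].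
  by apply: mem_nbh vf; rewrite !inE fe.
have sparseS C : C \subset S -> C != set0 -> #|C| < #|nbh A C|.
  move=> CS C0; apply: sparse => //.
  exact: leq_trans (subset_leq_card (nbhS _ CS)) nbhS4.
rewrite /more_singular; set Q := [set B in P | _]; set Q1 := [set B in P | _].
have -> : #|Q1| = #|S|.
  rewrite -(card_imset _ (@set1_inj E)); congr #|pred_of_set _|.
  apply/setP => B; rewrite inE; apply/andP/imsetP => [[BP /cards1P[e eB]]|[e]].
    by exists e; rewrite ?inE -?eB.
  by rewrite inE => eS ->; rewrite cards1.
move=> ltQ.
have S0 : S != set0 by rewrite -card_gt0; lia.
have Q2 : #|Q| <= 2 by have := sparseS S (subxx _) S0; lia.
have inQ e : e \in D -> e \notin S -> exists2 B, B \in Q & e \in B.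
  move=> eD eS; have [B BP eB] := inP e eD; exists B => //.
  rewrite inE BP; apply: contra eS => /cards1P[f eBf].
  by move: eB BP; rewrite eBf !inE => /eqP->.
have noCS C : circuit M C -> ~~ (C \subset S).
  move=> cC; apply/negP => CS.
  by have := sparseS C CS (circ_n0 C cC); rewrite -(hall_circuit cC) ltnNge leqnSn.
have [Q1' | Qgt1] := leqP #|Q| 1.
  have [B BP QB] : exists2 B, B \in P & Q \subset [set B].
    have [Q0|[B BQ]] := set_0Vmem Q.
      (* Without multiple classes any singular class can be removed to leave a circuit inside
         [S]. *)
      have [e] := set0Pn _ S0; rewrite inE => eP'.
      by exists [set e] => //; rewrite Q0 sub0set.
    exists B; first by move: BQ; rewrite inE => /andP[].
    by apply/subsetP => B' B'Q; rewrite inE; apply/eqP/(card_le1_eqP Q1').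
  case/negP: (noCS _ (circP B BP)); apply/subsetP => e; rewrite inE => /andP[eB eD].
  apply: contraNT eB => /(inQ e eD)[B' /(subsetP QB)].
  by rewrite inE => /eqP->.
have /cards2P[B1 [B2 [nB eQ]]] : #|Q| == 2 by rewrite eqn_leq Q2.
have B1Q : B1 \in Q by rewrite eQ !inE eqxx.
have B2Q : B2 \in Q by rewrite eQ !inE eqxx orbT.
have QP B : B \in Q -> B \in P by rewrite inE => /andP[].
have eS : (D :\: B1) :&: (D :\: B2) = S.
  apply/eqP; rewrite eqEsubset; apply/andP; split; apply/subsetP => e.
    rewrite in_setI !in_setD => /andP[/andP[e1 eD] /andP[e2 _]].
    apply: contraT => eS; have [B] := inQ e eD eS.
    by rewrite eQ !inE => /orP[]/eqP->; rewrite ?(negPf e1) ?(negPf e2).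
  move=> eS; have eD := subsetP SD e eS.
  have nQ B : B \in Q -> e \notin B.
    rewrite inE => /andP[BP]; apply: contra => eB.
    rewrite inE in eS; rewrite (disP _ _ _ BP eS eB (set11 e)).
    by rewrite cards1.
  by rewrite !inE eD !nQ.
have eD : (D :\: B1) :|: (D :\: B2) = D.
  rewrite -setDIr [B1 :&: B2](_ : _ = set0) ?setD0 //.
  apply/setP => e; rewrite !inE; apply/negP => /andP[e1 e2].
  by case/eqP: nB; exact: disP (QP _ B1Q) (QP _ B2Q) e1 e2.
(* The two circuits meet [#|D| + #|S| - 2] vertices in sum, and [D] meets at least [#|D| - 2], so
   [S] meets at most [#|S|]. *)
have := nbh_submod A (D :\: B1) (D :\: B2); have := cardsUI (D :\: B1) (D :\: B2).
rewrite eS eD; have := sparseS S (subxx _) S0; have := rank_hall_matroid A D.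
have := hall_circuit (circP _ (QP _ B1Q)); have := hall_circuit (circP _ (QP _ B2Q)).
lia.
Qed.

Hypothesis deg3 : forall v, 3 <= #|star setT v|.

(* Hall's theorem is applied from the vertex side: a matching of all vertices
   into the edges outside [C] is a basis. *)
Lemma dual_indep2 C : #|C| <= 2 -> C \in indep (dual M).
Proof.
move=> C2.
have h W : #|W| <= #|nbh (star (~: C)) W|.
  have [->|W0] := eqVneq W set0; first by rewrite cards0.
  (* [F] holds the edges meeting [W], [G] those inside; the degree sum over [W] counts the latter
     twice. *)
  pose F := nbh (star setT) W; pose G := [set e | A e \subset W].
  have FE e : (e \in F) = (0 < #|A e :&: W|).
    apply/bigcupP/card_gt0P => [[v vW]|[v]].
      by rewrite !inE => /= ve; exists v; rewrite !inE ve.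
    by rewrite !inE => /andP[ve vW]; exists v; rewrite ?inE.
  have eF : nbh (star (~: C)) W = F :\: C.
    apply/setP => e; rewrite inE; apply/bigcupP/andP => [[v vW]|[eC]].
      rewrite !inE => /andP[eC ve]; split=> //.
      by apply/bigcupP; exists v; rewrite ?inE.
      by case/bigcupP => v vW; rewrite !inE => ve; exists v; rewrite // !inE eC ve.
  have le3 : 3 * #|W| <= #|F| + #|G|.
    have : \sum_(v in W) 3 <= \sum_(v in W) #|star setT v| by apply: leq_sum.
    rewrite sum_nat_const mulnC sum_star => /leq_trans; apply.
    rewrite -!sum1_card (big_mkcond (mem F)) (big_mkcond (mem G)) -big_split /=.
    rewrite [leqLHS]big_mkcond; apply: leq_sum => e _; rewrite FE !inE /=.
    have [AW | AW] := boolP (A e \subset W).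
      by rewrite (setIidPl AW) A2.
    have : #|A e :&: W| < #|A e|.
      by apply: proper_card; rewrite properE subsetIl subsetI subxx.
    by rewrite A2; case: (#|_|) => [|[]].
  have GF : G \subset F.
    by apply/subsetP => e; rewrite FE inE => /setIidPl->; rewrite A2.
  have leG := subset_leq_card GF.
  (* The 2 pays for the edges of [C]. From four vertices on, [G \subset F] suffices; below that,
     sparsity bounds [G]. *)
  have leF : #|W| + 2 <= #|F|.
    move: W0; rewrite -card_gt0 => W0.
    have [W4 | W3] := leqP 4 #|W|; first lia.
    have [G0 | G0] := eqVneq G set0; first by move: le3; rewrite G0 cards0; lia.
    have GW : nbh A G \subset W by apply/bigcupsP => e; rewrite inE.
    have := subset_leq_card GW; have := sparse G0; lia.
  rewrite eF; have := cardsID C F; have := subset_leq_card (subsetIr F C); lia.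
have [f f_inj fC] := hall_matching h.
rewrite inE eqn_leq rankS ?subsetT //=.
apply: (@leq_trans #|V|).
  exact: leq_trans (rank_hall_matroid A setT) (max_card _).
rewrite -cardsT -(card_imset _ f_inj); apply: leq_rank.
  rewrite inE; apply/hallP => Y YT.
  have -> : #|Y| = #|f @^-1: Y|.
    rewrite -(card_imset _ f_inj); congr #|pred_of_set _|; apply/setP => e.
    apply/idP/imsetP => [eY | [v]]; last by rewrite inE => ? ->.
    by have /imsetP[v _ ev] := subsetP YT e eY; exists v; rewrite // inE -ev.
  apply: subset_leq_card; apply/subsetP => v; rewrite inE => fvY.
  by apply: mem_nbh fvY _; have := fC v; rewrite inE => /andP[].
by apply/subsetP => _ /imsetP[v _ ->]; have := fC v; rewrite inE => /andP[].
Qed.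

Lemma cosimple_hall_matroid : cosimple M.
Proof.
move=> C /andP[dC _]; rewrite ltnNge; apply: contra dC; exact: dual_indep2.
Qed.

End Graph.

(** * The Petersen graph, checked by computing with lists of edges *)

Fixpoint sublists (T : Type) k (s : seq T) : seq (seq T) :=
  match k, s with
  | 0, _ => [:: [::]]
  | k'.+1, [::] => [::]
  | k'.+1, x :: s' => map (cons x) (sublists k' s') ++ sublists k s'
  end.

Lemma subseq_sublists (T : eqType) (t s : seq T) :
  subseq t s -> t \in sublists (size t) s.
Proof.
elim: s t => [|x s IHs] [|y t] //=; rewrite mem_cat.
case: eqP => [-> | _] ts; last by rewrite (IHs (y :: t)) ?orbT.
by rewrite map_f // IHs.
Qed.

Lemma card_ord_mem n (s : seq nat) : uniq s -> all (ltn^~ n) s ->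
  #|[set i : 'I_n | val i \in s]| = size s.
Proof.
move=> s_uniq /allP ltn_s.
rewrite cardsE cardE -(size_map val); apply/perm_size/uniq_perm => //.
  by rewrite (map_inj_uniq val_inj) enum_uniq.
move=> i; apply/mapP/idP => [[j] | si]; first by rewrite mem_enum => sj ->.
by exists (Ordinal (ltn_s i si)); rewrite ?mem_enum.
Qed.

(* Outer pentagon 0..4, spokes, inner pentagram 5..9. *)
Definition petersen_ends (e : nat) : seq nat :=
  if e < 5 then [:: e; (e + 1) %% 5]
  else if e < 10 then [:: e - 5; e]
  else [:: e - 5; (e + 2) %% 5 + 5].

Definition petersen (e : 'I_15) : {set 'I_10} :=
  [set v : 'I_10 | val v \in petersen_ends e].

Lemma petersen_endsP (e : 'I_15) :
  let s := petersen_ends e in [&& uniq s, all (ltn^~ 10) s & size s == 2].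
Proof.
suff /allP : all (fun e => let s := petersen_ends e in
    [&& uniq s, all (ltn^~ 10) s & size s == 2]) (iota 0 15).
  by apply; rewrite mem_iota ltn_ord.
by [].
Qed.

Lemma petersen2 e : #|petersen e| = 2.
Proof. by have /and3P[u a /eqP s2] := petersen_endsP e; rewrite card_ord_mem. Qed.

Lemma petersen_deg3 v : 3 <= #|star petersen setT v|.
Proof.
have -> : star petersen setT v
    = [set e | val e \in [seq e <- iota 0 15 | val v \in petersen_ends e]].
  by apply/setP => e; rewrite !inE mem_filter mem_iota ltn_ord !andbT.
rewrite card_ord_mem ?filter_uniq ?iota_uniq //; last first.
  by apply/allP => e; rewrite mem_filter mem_iota => /andP[].
suff /allP : all (fun v => 3 <= size [seq e <- iota 0 15 | v \in petersen_ends e])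
    (iota 0 10) by apply; rewrite mem_iota ltn_ord.
by vm_compute.
Qed.

(** Girth 5 in computable form: one to four edges always form a forest. *)
Lemma petersen_sublists : all (fun k => all (fun t =>
    k < size (undup (flatten (map petersen_ends t)))) (sublists k (iota 0 15)))
  (iota 1 4).
Proof. by vm_compute. Qed.

Lemma nbh_petersen (S : {set 'I_15}) :
  #|nbh petersen S|
  = size (undup (flatten [seq petersen_ends (val e) | e <- enum S])).
Proof.
rewrite -(@card_ord_mem 10) ?undup_uniq //.
  congr #|pred_of_set _|; apply/setP => v; rewrite inE mem_undup.
  apply/bigcupP/flatten_mapP => -[e]; first by rewrite inE; exists e; rewrite ?mem_enum.
  by rewrite mem_enum; exists e; rewrite ?inE.
apply/allP => v; rewrite mem_undup => /flatten_mapP[e _].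
by have /and3P[_ /allP a _] := petersen_endsP e; exact: a.
Qed.

Lemma petersen_sparse (S : {set 'I_15}) : S != set0 ->
  #|nbh petersen S| <= 4 -> #|S| < #|nbh petersen S|.
Proof.
have small (C : {set 'I_15}) : 0 < #|C| <= 4 -> #|C| < #|nbh petersen C|.
  move=> C4; rewrite nbh_petersen map_comp.
  have /allP/(_ #|C|) := petersen_sublists; rewrite mem_iota => /(_ C4)/allP; apply.
  rewrite [in sublists _]cardE -(size_map val); apply: subseq_sublists.
  rewrite -val_enum_ord; apply: map_subseq; rewrite enumT; exact: filter_subseq.
rewrite -card_gt0 => S0 N4; have [S4 | S4] := leqP #|S| 4; first by rewrite small ?S0.
(* Four of the edges already meet five vertices, so a larger [S] contradicts [N4]. *)
have [C CS C4] : exists2 C : {set 'I_15}, C \subset S & #|C| = 4.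
  have /card_geqP[t [t_uniq t4 tS]] := ltnW S4.
  exists [set e in t]; first by apply/subsetP => e; rewrite inE => /tS.
  by rewrite cardsE (card_uniqP t_uniq).
have := small C; rewrite C4 => /(_ isT).
by have := subset_leq_card (nbhS petersen CS); lia.
Qed.

Theorem corollary12 :
  (exists (T : finType) (M : matroid T),
     [/\ gammoid M, cosimple M, 2 <= corank M &
         ~ exists D : {set T}, positive_double_circuit M D]) /\
  (exists (T : finType) (M : matroid T),
     [/\ gammoid M, simple M, 2 <= rank M [set: T] &
         ~ exists L : {set T}, positive_coline M L]).
Proof.
pose M := hall_matroid petersen.
have gM : gammoid M by apply: gammoid_transversal; exact: transversal_hall.
have cM : cosimple M.
  exact: cosimple_hall_matroid petersen2 petersen_sparse petersen_deg3.
have rM : 2 <= corank M.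
  (* Any two distinct edges would do. *)
  have := dual_indep2 petersen2 petersen_sparse petersen_deg3 (C := [set ord0; ord_max]).
  by rewrite cards2 => /(_ isT)/leq_rank/(_ (subsetT _)); rewrite cards2.
have dM D : ~ positive_double_circuit M D.
  exact: (no_positive_double_circuit petersen2 petersen_sparse).
split; first by exists 'I_15, M; split=> // -[D]; exact: dM.
(* Simplicity and rank of [dual M] are [cM] and [rM] by definition. *)
exists 'I_15, (dual M); split=> //; first exact: gammoid_dual.
by case=> L /positive_coline_dual; exact: dM.
Qed.
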